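(* Let $n,q,d$ be positive integers with $q\ge 3$ and $d\le n$, and let $H(n,q,d)$ be the $q$-ary Hamming graph of length $n$ with distance $d$. \begin{enumerate} \item If $d=\frac{(q-1)n}{q}$, then $\chi_Q(H(n,q,d))\ge (q-1)(n-1)+1$. \item If $d\ge \frac{(q-1)n+1}{q}$, then $\chi_Q(H(n,q,d))\ge \dfrac{qd}{qd-(q-1)n}$. \end{enumerate}
   Context: For a $q$-element alphabet $\Sigma$, the Hamming graph $H(n,q,d)$ has vertex set $\Sigma^n$, two vertices being adjacent iff they differ in exactly $d$ coordinates. A quantum homomorphism from a graph $G$ to a graph $H$ is a family of Hermitian matrices $\{P_{v,\alpha}: v\in V(G),\alpha\in V(H)\}\subseteq\mathbb{C}^{k\times k}$ (some $k\ge1$) such that (1) for each $v$, $\sum_\alpha P_{v,\alpha}=I$ and $P_{v,\alpha}P_{v,\beta}=\delta_{\alpha\beta}P_{v,\alpha}$; (2) $P_{u,\alpha}P_{v,\beta}=0$ whenever $u,v$ are adjacent in $G$ and $\alpha,\beta$ are non-adjacent in $H$. The quantum chromatic number $\chi_Q(G)$ is the least $r$ such that there is a quantum homomorphism from $G$ to the complete graph $K_r$. *)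

(* Defs.v *)
From HB Require Import structures.
From mathcomp Require Import all_boot all_order all_algebra.
From mathcomp Require Import boolp reals.
From mathcomp Require Import complex.

Set Implicit Arguments.
Unset Strict Implicit.
Unset Printing Implicit Defensive.

Import Order.TTheory GRing.Theory Num.Theory.

Local Open Scope ring_scope.
Local Open Scope complex_scope.

Record sgraph := SGraph {
  svertex :> finType;
  sadj : rel svertex;
  sadj_sym : symmetric sadj;
  sadj_irr : irreflexive sadj }.

Definition complete_rel (r : nat) : rel 'I_r := fun a b => a != b.

Lemma complete_sym r : symmetric (@complete_rel r).
Proof. by move=> a b; rewrite /complete_rel eq_sym. Qed.

Lemma complete_irr r : irreflexive (@complete_rel r).
Proof. by move=> a; rewrite /complete_rel eqxx. Qed.

Definition complete_graph (r : nat) : sgraph :=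
  SGraph (@complete_sym r) (@complete_irr r).

Definition hamming_dist (n : nat) (S : finType) (x y : {ffun 'I_n -> S}) : nat :=
  #|[set i | x i != y i]|.

Definition hamming_rel (n : nat) (S : finType) (d : nat) :
    rel {ffun 'I_n -> S} :=
  fun x y => hamming_dist x y == d.

Lemma hamming_sym n S d : symmetric (@hamming_rel n S d).
Proof.
move=> x y; rewrite /hamming_rel /hamming_dist; congr (#|pred_of_set _| == d).
by apply/setP => i; rewrite !inE eq_sym.
Qed.

Lemma hamming_irr n S d : (0 < d)%N -> irreflexive (@hamming_rel n S d).
Proof.
move=> d_gt0 x; rewrite /hamming_rel /hamming_dist.
have -> : [set i | x i != x i] = set0 by apply/setP => i; rewrite !inE eqxx.
by rewrite cards0 eq_sym; apply/negbTE; rewrite -lt0n.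
Qed.

(* Positivity of d is needed for the graph to be loopless. *)
Definition hamming_graph (n : nat) (S : finType) (d : nat)
    (d_gt0 : (0 < d)%N) : sgraph :=
  SGraph (@hamming_sym n S d) (@hamming_irr n S d d_gt0).

Record is_quantum_hom (R : realType) (G H : sgraph) (k : nat)
    (P : G -> H -> 'M[R[i]]_k) : Prop := IsQuantumHom {
  qhom_herm : forall v a, P v a \is hermsymmx;
  qhom_sum : forall v, \sum_a P v a = 1%:M;
  qhom_orth : forall v a b,
    P v a *m P v b = if a == b then P v a else 0;
  qhom_adj : forall u v a b,
    sadj u v -> ~~ sadj a b -> P u a *m P v b = 0 }.

Definition quantum_hom (R : realType) (G H : sgraph) : Prop :=
  exists k : nat, (0 < k)%N /\
    exists P : G -> H -> 'M[R[i]]_k, is_quantum_hom P.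

(* Colour every vertex by its own colour, with 1 x 1 projections. *)
Lemma quantum_colorable_card (R : realType) (G : sgraph) :
  quantum_hom R G (complete_graph #|G|).
Proof.
exists 1%N; split => //.
exists (fun (v : G) (a : complete_graph #|G|) => ((enum_rank v == a)%:R)%:M).
split.
- move=> v a; apply/is_hermitianmxP; rewrite expr0 scale1r.
  by rewrite tr_scalar_mx map_scalar_mx /= conjC_nat.
- move=> v; rewrite (bigD1 (enum_rank v)) //= eqxx big1 ?addr0 // => a.
  by rewrite eq_sym => /negPf ->; rewrite raddf0.
- move=> v a b; rewrite -scalar_mxM -natrM mulnb.
  case: (eqVneq a b) => [<-|ab]; first by rewrite andbb.
  case: eqP => [->|_] /=; last by rewrite raddf0.
  by rewrite (negPf ab) raddf0.
- move=> u v a b uv; rewrite /= /complete_rel negbK => /eqP <-.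
  rewrite -scalar_mxM -natrM mulnb.
  case: eqP => [<-|_] /=; last by rewrite raddf0.
  case: eqP => [/enum_rank_inj vu|_]; last by rewrite raddf0.
  by rewrite vu sadj_irr in uv.
Qed.

Lemma quantum_colorable_ex (R : realType) (G : sgraph) :
  exists r, `[< quantum_hom R G (complete_graph r) >].
Proof. by exists #|G|; apply/asboolP; exact: quantum_colorable_card. Qed.

Definition quantum_chromatic_number (R : realType) (G : sgraph) : nat :=
  ex_minn (quantum_colorable_ex R G).

(* Main.v *)
Require Import Defs.
From Stdlib Require Import ZArith.
From mathcomp Require Import all_boot all_order all_algebra.
From mathcomp Require Import boolp reals complex ring lra zify ssrZ.

(** Write p = q - 1 and let K_d(i) be the coefficient of X^d in
    (1 - X)^i (1 + p X)^(n - i), the eigenvalues of H(n,q,d).  A quantum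
    r-colouring satisfies the Hoffman bound r >= 1 - K_d(0) / lambda for every
    negative lower bound lambda of the K_d(i), 1 <= i <= n: for each colour, the
    Gram matrix tr(P_u P_v) is positive semidefinite and vanishes on edges, so one
    pairs it with the idempotents of the Hamming scheme.

    It remains to bound K_d(i) below.  Put m = q d - p n.  For m <= 1 one shows
    p (n - 1 + m) |K_d(i)| <= K_d(0) when n >= 14: for 2 i <= n + 1 by the
    three-term recurrence in i, and for larger i from the orthogonality relation
    sum_i C(n,i) p^i K_d(i)^2 = q^n K_d(0), because K_d(0) is the largest of the
    n + 1 terms of (1 + p)^n.  The finitely many cases with n <= 13 are computed.
    For m >= 2 the bound p n K_d(i) >= - m K_d(0) follows by induction on n. *)

Set Implicit Arguments.
Unset Strict Implicit.
Unset Printing Implicit Defensive.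

Import Order.TTheory GRing.Theory Num.Theory.

Local Open Scope ring_scope.

(** * Krawtchouk coefficients and the idempotents of the Hamming scheme *)

Definition kraw_poly (F : comNzRingType) (p n i : nat) : {poly F} :=
  (1 - 'X) ^+ i * (1 + p%:R *: 'X) ^+ (n - i).

Definition kraw (F : comNzRingType) (p n i d : nat) : F :=
  (kraw_poly F p n i)`_d.

(* #|S|^n times the primitive idempotent of the Hamming scheme attached to the
   set T of coordinates. *)
Definition scheme_ker (F : comNzRingType) (n : nat) (S : finType)
    (T : {set 'I_n}) (u v : {ffun 'I_n -> S}) : F :=
  \prod_i (if i \in T then #|S|%:R *+ (u i == v i) - 1 else 1).

(** The coefficients are integers, so they can be computed in [Z], estimated in [int] and used in
    the complex field. *)
Lemma rmorph_kraw (F1 F2 : comNzRingType) (f : {rmorphism F1 -> F2}) p n i d :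
  f (kraw F1 p n i d) = kraw F2 p n i d.
Proof.
rewrite /kraw /kraw_poly -coef_map rmorphM !rmorphXn /= rmorphB rmorphD /=.
by rewrite rmorph1 map_polyX map_polyZ /= map_polyX rmorph_nat.
Qed.

Lemma prod_set_const (F : comNzRingType) n (T : {set 'I_n}) (a b : F) :
  \prod_i (if i \in T then a else b) = a ^+ #|T| * b ^+ (n - #|T|).
Proof.
rewrite (bigID (mem T)) /=; congr (_ * _).
  rewrite (eq_bigr (fun=> a)) => [|i ->//].
  by rewrite prodr_const.
rewrite (eq_bigr (fun=> b)) => [|i /negPf->//].
rewrite prodr_const; congr (_ ^+ _).
by apply/eqP; rewrite -(eqn_add2l #|T|) cardC card_ord subnKC //
  -[leqRHS]card_ord max_card.
Qed.

Section SchemeKernel.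
Variables (F : comNzRingType) (n : nat) (S : finType).
Implicit Types (T U : {set 'I_n}) (u v w : {ffun 'I_n -> S}).
Local Notation E := (@scheme_ker F n S).

Lemma scheme_ker_sym T u v : E T u v = E T v u.
Proof. by apply: eq_bigr => i _; rewrite eq_sym. Qed.

Lemma scheme_ker0 u v : E set0 u v = 1.
Proof. by apply: big1 => i _; rewrite inE. Qed.

Lemma scheme_ker_diag T u : (0 < #|S|)%N -> E T u u = (#|S|.-1)%:R ^+ #|T|.
Proof.
move=> S_gt0; have := prod_set_const T ((#|S|.-1)%:R : F) 1.
rewrite expr1n mulr1 => <-.
apply: eq_bigr => i _; case: ifP => // _.
by rewrite eqxx mulr1n -{1}(prednK S_gt0) -natr1 addrK.
Qed.

(** The sum over w factors over the coordinates. The matrix q [x = y] - 1 has zero row and column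
    sums and squares to q times itself, so a coordinate lying in exactly one of T and U makes the
    product vanish. *)
Lemma scheme_ker_mul T U u v :
  \sum_w E T u w * E U w v =
    if T == U then #|S|%:R ^+ n * E T u v else 0.
Proof.
transitivity (\sum_(w : {ffun 'I_n -> S}) \prod_i
    ((if i \in T then #|S|%:R *+ (u i == w i) - 1 else 1) *
     (if i \in U then #|S|%:R *+ (w i == v i) - 1 else 1)) : F).
  by apply: eq_bigr => w _; rewrite /scheme_ker -big_split.
rewrite -(bigA_distr_bigA (fun i s =>
    ((if i \in T then #|S|%:R *+ (u i == s) - 1 else 1) *
     (if i \in U then #|S|%:R *+ (s == v i) - 1 else 1) : F))) /=.
have delta (x : S) (f : S -> F) : \sum_s (#|S|%:R *+ (x == s)) * f s = #|S|%:R * f x.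
  rewrite (bigD1 x) //= eqxx big1 ?addr0 // => s /negPf sx.
  by rewrite eq_sym sx mul0r.
have sum1 : \sum_(s : S) 1 = #|S|%:R :> F by rewrite sumr_const.
have sumE (x : S) : \sum_s (#|S|%:R *+ (x == s) - 1) = 0 :> F.
  rewrite sumrB sum1; under eq_bigr do rewrite -[_ *+ _]mulr1.
  by rewrite (delta x (fun=> 1)) mulr1 subrr.
have sumE' (x : S) : \sum_s (#|S|%:R *+ (s == x) - 1) = 0 :> F.
  by rewrite -[RHS](sumE x); apply: eq_bigr => s _; rewrite eq_sym.
case: eqP => [<-|/eqP neTU].
  have -> : #|S|%:R ^+ n = \prod_(i < n) #|S|%:R :> F.
    by rewrite prodr_const card_ord.
  rewrite /scheme_ker -big_split /=.
  apply: eq_bigr => i _; case: ifP => _; last first.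
    by under eq_bigr do rewrite mulr1; rewrite sum1 mulr1.
  under eq_bigr do rewrite mulrBl mul1r.
  by rewrite sumrB (delta _ (fun s => #|S|%:R *+ (s == v i) - 1)) sumE' subr0.
have /existsP[i iTU] : [exists i, (i \in T) != (i \in U)].
  apply: contraNT neTU => /existsPn h; apply/eqP/setP => i.
  by apply/eqP; move: (h i); rewrite negbK.
rewrite (bigD1 i) //= [X in X * _](_ : _ = 0) ?mul0r //.
case: (i \in T) iTU; case: (i \in U) => // _.
  by under eq_bigr do rewrite mulr1; rewrite sumE.
by under eq_bigr do rewrite mul1r; rewrite sumE'.
Qed.

(* Coordinatewise, q [x = y] + q X [x <> y] splits as
   (1 - X)(q [x = y] - 1) + (1 + (q - 1) X); expand the product over the
   coordinates and read off the coefficient of X^d. *)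
Lemma hamming_relE d u v : (0 < #|S|)%N ->
  #|S|%:R ^+ n *+ hamming_rel d u v =
    \sum_(T : {set 'I_n}) kraw F #|S|.-1 n #|T| d * E T u v.
Proof.
move=> S_gt0; set p := #|S|.-1.
have Sp : #|S| = p.+1 by rewrite prednK.
have /(congr1 (fun r : {poly F} => r`_d)) :
    \prod_i ((1 - 'X) * (#|S|%:R *+ (u i == v i) - 1)%:P + (1 + p%:R *: 'X)) =
    \sum_(T : {set 'I_n}) kraw_poly F p n #|T| * (E T u v)%:P.
  rewrite bigA_distr; apply: eq_bigr => T _.
  rewrite /kraw_poly -prod_set_const /scheme_ker rmorph_prod -big_split /=.
  by apply: eq_bigr => i _; case: ifP => // _; rewrite rmorph1 mulr1.
rewrite coef_sum; under [in RHS]eq_bigr do rewrite coefMC.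
move=> <-.
rewrite (eq_bigr (fun i => #|S|%:R%:P * (if i \in [set i | u i != v i] then 'X else 1)))
  => [|i _].
  rewrite big_split /= prodr_const card_ord prod_set_const expr1n mulr1.
  rewrite -polyC_exp coefCM coefXn /hamming_rel /hamming_dist eq_sym.
  by rewrite mulr_natr.
rewrite inE Sp -mul_polyC; case: eqP => _ /=; rewrite -natr1 rmorphB rmorphMn rmorphD /=
  !polyC1.
  by rewrite mulr1n; ring.
by rewrite mulr0n; ring.
Qed.
End SchemeKernel.

(** * The Hoffman bound for quantum colourings *)

Lemma kraw_deg0 (F : comNzRingType) p n i : kraw F p n i 0 = 1.
Proof.
rewrite /kraw /kraw_poly -horner_coef0 hornerM !horner_exp !hornerE.
by rewrite ?mulr0 ?subr0 ?addr0 ?expr1n ?mulr1.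
Qed.

Lemma hamming_rel0 n (S : finType) (u v : {ffun 'I_n -> S}) :
  hamming_rel 0 u v = (u == v).
Proof.
rewrite /hamming_rel /hamming_dist cards_eq0; apply/eqP/eqP => [uv | ->].
  apply/ffunP => i; apply/eqP; move/setP/(_ i): uv.
  by rewrite !inE => /negbFE.
by apply/setP => i; rewrite !inE eqxx.
Qed.

Lemma mxtrace_sqr_ge0 (C : numClosedFieldType) k (A : 'M[C]_k) :
  (forall i j, A i j = (A j i)^*) -> 0 <= \tr (A *m A).
Proof.
move=> Aherm; apply: sumr_ge0 => i _; rewrite mxE; apply: sumr_ge0 => j _.
by rewrite [A j i]Aherm mul_conjC_ge0.
Qed.

Lemma conj_scheme_ker (C : numClosedFieldType) n (S : finType) T u v :
  (@scheme_ker C n S T u v)^* = scheme_ker C T u v.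
Proof.
rewrite /scheme_ker rmorph_prod; apply: eq_bigr => i _; case: ifP => _.
  by rewrite rmorphB rmorphMn rmorph_nat rmorph1.
by rewrite rmorph1.
Qed.

Section QuantumHoffman.
Variables (C : numClosedFieldType) (S : finType) (n d r k : nat).
Hypotheses (S_gt0 : (0 < #|S|)%N) (k_gt0 : (0 < k)%N).
Variable P : {ffun 'I_n -> S} -> 'I_r -> 'M[C]_k.
Hypothesis P_herm : forall v a i j, P v a i j = (P v a j i)^*.
Hypothesis P_sum : forall v, \sum_a P v a = 1%:M.
Hypothesis P_idem : forall v a, P v a *m P v a = P v a.
Hypothesis P_adj : forall u v a, hamming_rel d u v -> P u a *m P v a = 0.

Local Notation p := #|S|.-1.
Let N : C := #|S|%:R ^+ n.
Let N_gt0 : 0 < N. Proof. by rewrite exprn_gt0 // ltr0n. Qed.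

Definition scheme_weight (T : {set 'I_n}) : C :=
  \sum_a \sum_u \sum_v scheme_ker C T u v * \tr (P u a *m P v a).

Lemma tr_linear_comb (f g : {ffun 'I_n -> S} -> C) a :
  \tr ((\sum_u f u *: P u a) *m (\sum_u g u *: P u a)) =
  \sum_u \sum_v f u * g v * \tr (P u a *m P v a).
Proof.
rewrite mulmx_suml raddf_sum; apply: eq_bigr => u _ /=.
rewrite mulmx_sumr raddf_sum; apply: eq_bigr => v _ /=.
by rewrite -scalemxAl -scalemxAr !mxtraceZ mulrA.
Qed.

(** Since E_T squared is q^n E_T, multiplying by q^n turns the weight into a sum of squared
    Frobenius norms of Hermitian matrices. *)
Lemma scheme_weight_ge0 T : 0 <= scheme_weight T.
Proof.
rewrite -(pmulr_rge0 _ N_gt0).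
suff -> : N * scheme_weight T = \sum_a \sum_w
    \tr ((\sum_u scheme_ker C T w u *: P u a) *m
         (\sum_u scheme_ker C T w u *: P u a)).
  apply: sumr_ge0 => a _; apply: sumr_ge0 => w _; apply: mxtrace_sqr_ge0 => i j.
  rewrite !summxE rmorph_sum; apply: eq_bigr => u _.
  by rewrite !mxE rmorphM /= conj_scheme_ker -P_herm.
rewrite mulr_sumr; apply: eq_bigr => a _.
under [RHS]eq_bigr do rewrite tr_linear_comb.
rewrite [RHS]exchange_big mulr_sumr; apply: eq_bigr => u _ /=.
rewrite [RHS]exchange_big mulr_sumr; apply: eq_bigr => v _ /=.
rewrite -mulr_suml mulrA; congr (_ * _).
have := scheme_ker_mul C T T u v; rewrite eqxx => <-.
by apply: eq_bigr => w _; rewrite scheme_ker_sym.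
Qed.

(** Used at two distances: e = d, where adjacency kills every term, and e = 0, where only u = v
    survives. *)
Lemma sum_kraw_weight e :
  \sum_(T : {set 'I_n}) kraw C p n #|T| e * scheme_weight T =
  \sum_a \sum_u \sum_v N *+ hamming_rel e u v * \tr (P u a *m P v a).
Proof.
rewrite /scheme_weight; under eq_bigr do rewrite mulr_sumr.
rewrite exchange_big; apply: eq_bigr => a _ /=.
under eq_bigr do rewrite mulr_sumr.
rewrite exchange_big; apply: eq_bigr => u _ /=.
under eq_bigr do rewrite mulr_sumr.
rewrite exchange_big; apply: eq_bigr => v _ /=.
rewrite /N hamming_relE // mulr_suml.
by apply: eq_bigr => T _; rewrite mulrA.
Qed.

Lemma sum_kraw_weight_adj :
  \sum_(T : {set 'I_n}) kraw C p n #|T| d * scheme_weight T = 0.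
Proof.
rewrite sum_kraw_weight; apply: big1 => a _; apply: big1 => u _.
apply: big1 => v _; case: (boolP (hamming_rel d u v)) => uv.
  by rewrite P_adj // mxtrace0 mulr0.
by rewrite mulr0n mul0r.
Qed.

Lemma sum_scheme_weight : \sum_T scheme_weight T = N * N * k%:R.
Proof.
have := sum_kraw_weight 0; under eq_bigr do rewrite kraw_deg0 mul1r.
move=> ->; rewrite exchange_big /=.
have -> : N * N * k%:R = \sum_(u : {ffun 'I_n -> S}) N * k%:R.
  by rewrite sumr_const card_ffun card_ord -[RHS]mulr_natl natrX mulrA.
apply: eq_bigr => u _.
rewrite -[k%:R](mxtrace1 C k) -(P_sum u) raddf_sum mulr_sumr /=.
apply: eq_bigr => a _; rewrite (bigD1 u) //= hamming_rel0 eqxx mulr1n P_idem.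
rewrite big1 ?addr0 // => v /negPf vu.
by rewrite hamming_rel0 eq_sym vu mulr0n mul0r.
Qed.

(** Cauchy-Schwarz over the colours: with A_a the sum of the P_u,a over u, the A_a add up to N I,
    and the inequality is the expansion of sum_a tr (r A_a - N I)^2 >= 0. *)
Lemma scheme_weight0_ge : N * N * k%:R <= r%:R * scheme_weight set0.
Proof.
set A := fun a => \sum_u P u a.
have w0E : scheme_weight set0 = \sum_a \tr (A a *m A a).
  apply: eq_bigr => a _.
  have := tr_linear_comb (fun=> 1) (fun=> 1) a.
  under eq_bigr do rewrite scale1r.
  move=> ->; apply: eq_bigr => u _; apply: eq_bigr => v _.
  by rewrite scheme_ker0 mulr1.
have AE : \sum_a A a = N%:M.
  rewrite exchange_big /=; under eq_bigr do rewrite P_sum.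
  by rewrite sumr_const card_ffun card_ord -scaler_nat natrX scalemx1.
(* Without colours the empty sum would equal N I, whose trace N k is nonzero. *)
have r_gt0 : (0 < r)%N.
  case: (posnP r) => // r0; move: AE; rewrite big1 => [|a]; last first.
    by have := ltn_ord a; rewrite [X in (_ < X)%N]r0.
  move=> /(congr1 mxtrace); rewrite mxtrace0 mxtrace_scalar => /esym/eqP.
  by rewrite mulrn_eq0 (gt_eqF N_gt0) orbF (gtn_eqF k_gt0).
rewrite -subr_ge0 -(pmulr_rge0 (x := r%:R)) ?ltr0n //.
suff -> : r%:R * (r%:R * scheme_weight set0 - N * N * k%:R) =
    \sum_a \tr ((r%:R *: A a - N%:M) *m (r%:R *: A a - N%:M)).
  apply: sumr_ge0 => a _; apply: mxtrace_sqr_ge0 => i j.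
  rewrite !mxE !summxE rmorphB rmorphM rmorph_nat rmorphMn rmorphXn rmorph_nat.
  rewrite (eq_sym j) rmorph_sum; congr (_ * _ - _).
  by apply: eq_bigr => u _; apply: P_herm.
transitivity (\sum_a (r%:R ^+ 2 * \tr (A a *m A a) - 2 * r%:R * N * \tr (A a)
                      + N * N * k%:R)).
  rewrite big_split sumrB /= -!mulr_sumr -w0E -raddf_sum /= AE mxtrace_scalar.
  rewrite sumr_const card_ord -[N *+ k]mulr_natr -[_ *+ r]mulr_natr; ring.
apply: eq_bigr => a _.
rewrite mulmxBl !mulmxBr !raddfB /= -!scalemxAl -!scalemxAr !mul_scalar_mx.
rewrite !mul_mx_scalar !mxtraceZ mxtrace_scalar -[N *+ k]mulr_natr; ring.
Qed.

(** The Hoffman bound for lambda = - e K_d(0) / c, cleared of denominators: 1 - K_d(0) / lambda = (c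
    + e) / e. The terms (c K_d(|T|) + e K_d(0)) w_T with T nonempty are nonnegative and add up to
    K_d(0) (e N^2 k - (c + e) w_0); the lower bound on w_0 then gives the claim. *)
Lemma quantum_hoffman (c e : int) : 0 <= c -> 0 <= e ->
  0 < kraw int p n 0 d ->
  (forall i, (0 < i <= n)%N -> 0 <= c * kraw int p n i d + e * kraw int p n 0 d) ->
  c + e <= e * r%:Z.
Proof.
move=> c_ge0 e_ge0 D_gt0 eig.
set D : C := kraw C p n 0 d.
have krawE i : kraw C p n i d = (kraw int p n i d)%:~R.
  by rewrite -(rmorph_kraw (intmul 1 : {rmorphism int -> C})).
have DC_gt0 : 0 < D by rewrite /D krawE ltr0z.
set w0 := scheme_weight set0.
have w0_ge0 : 0 <= w0 by exact: scheme_weight_ge0.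
have w0_le : (c + e)%:~R * w0 <= e%:~R * (N * N * k%:R).
  rewrite -(ler_pM2l DC_gt0) -subr_ge0.
  rewrite [X in 0 <= X](_ : _ = \sum_(T | T != set0)
    (c * kraw int p n #|T| d + e * kraw int p n 0 d)%:~R * scheme_weight T).
    apply: sumr_ge0 => T T0; rewrite mulr_ge0 ?scheme_weight_ge0 // ler0z eig //.
    by rewrite card_gt0 T0 -[leqRHS]card_ord max_card.
  have := sum_scheme_weight; have := sum_kraw_weight_adj.
  rewrite (bigD1 set0) //= cards0 -/w0 -/D => /eqP; rewrite addrC addr_eq0 => /eqP sumK.
  rewrite (bigD1 set0) //= -/w0 => <-.
  under [RHS]eq_bigr do rewrite rmorphD !rmorphM /= -!krawE mulrDl -!mulrA.
  rewrite big_split /= -!mulr_sumr sumK -/D rmorphD /=; ring.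
have NNk_gt0 : 0 < N * N * k%:R by rewrite !mulr_gt0 ?ltr0n.
suff : (c + e)%:~R * (N * N * k%:R) <= (e * r%:Z)%:~R * (N * N * k%:R) :> C.
  by rewrite ler_pM2r // ler_int.
apply: (le_trans (y := (c + e)%:~R * (r%:R * w0))).
  by rewrite ler_wpM2l ?ler0z ?addr_ge0 // scheme_weight0_ge.
by rewrite mulrCA rmorphM /= -pmulrn [X in _ <= X * _]mulrC -[leRHS]mulrA ler_wpM2l ?ler0n.
Qed.
End QuantumHoffman.

(** * Krawtchouk polynomials *)

Section KrawtchoukIdentities.
Variables (F : comNzRingType) (p : nat).
Local Notation K := (kraw F p).

Lemma kraw0 n d : K n 0 d = ('C(n, d) * p ^ d)%:R.
Proof.
rewrite /kraw /kraw_poly expr0 mul1r subn0 exprDn coef_sum.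
rewrite (eq_bigr (fun j : 'I_n.+1 => ('C(n, j) * p ^ j)%:R * (j == d :> nat)%:R)).
  case: (ltnP n d) => [nd | dn].
    rewrite bin_small // mul0n big1 // => j _.
    by rewrite (ltn_eqF (leq_trans (ltn_ord j) nd)) mulr0.
  rewrite (bigD1 (Ordinal (dn : (d < n.+1)%N))) //= eqxx mulr1 big1 ?addr0 // => j.
  by rewrite -val_eqE => /negPf /= ->; rewrite mulr0.
move=> j _; rewrite expr1n mul1r exprZn coefMn coefZ coefXn eq_sym.
by rewrite natrM natrX -[LHS]mulr_natl mulrA.
Qed.

Lemma kraw_diag n d : K n n d = (-1) ^+ d * 'C(n, d)%:R.
Proof.
rewrite /kraw /kraw_poly subnn expr0 mulr1 -scaleN1r exprDn coef_sum.
rewrite (eq_bigr (fun j : 'I_n.+1 => (-1) ^+ j * 'C(n, j)%:R * (j == d :> nat)%:R)).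
  case: (ltnP n d) => [nd | dn].
    rewrite bin_small // mulr0 big1 // => j _.
    by rewrite (ltn_eqF (leq_trans (ltn_ord j) nd)) mulr0.
  rewrite (bigD1 (Ordinal (dn : (d < n.+1)%N))) //= eqxx mulr1 big1 ?addr0 // => j.
  by rewrite -val_eqE => /negPf /= ->; rewrite mulr0.
move=> j _; rewrite expr1n mul1r exprZn coefMn coefZ coefXn eq_sym.
by rewrite -[LHS]mulr_natr mulrAC.
Qed.

Lemma krawS n i d : (i <= n)%N ->
  K n.+1 i d.+1 = K n i d.+1 + p%:R * K n i d.
Proof.
move=> le_in; rewrite /kraw.
have -> : kraw_poly F p n.+1 i = kraw_poly F p n i + p%:R *: (kraw_poly F p n i * 'X).
  rewrite /kraw_poly subSn // exprSr mulrA mulrDr mulr1.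
  by rewrite -scalerAr.
by rewrite coefD coefZ coefMX.
Qed.

Lemma coef_Xderiv (f : {poly F}) d : ('X * f^`())`_d = d%:R * f`_d.
Proof. by case: d => [|d]; rewrite coefXM ?mul0r //= coef_deriv mulr_natl. Qed.

(* With G_i the generating polynomial,
   p (n - i) G_(i+1) + i G_(i-1) = (i + p (n - i)) G_i - (p + 1) X G_i'. *)
Lemma kraw_rec a b d :
  p%:R * b.+1%:R * K (a + b).+2 a.+2 d + a.+1%:R * K (a + b).+2 a d =
  (a.+1%:R + p%:R * b.+1%:R - p.+1%:R * d%:R) * K (a + b).+2 a.+1 d.
Proof.
have /(congr1 (fun r : {poly F} => r`_d)) :
    (p * b.+1)%:R *: kraw_poly F p (a + b).+2 a.+2 + a.+1%:R *: kraw_poly F p (a + b).+2 a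
    = (a.+1 + p * b.+1)%:R *: kraw_poly F p (a + b).+2 a.+1
      - p.+1%:R *: ('X * (kraw_poly F p (a + b).+2 a.+1)^`()).
  rewrite /kraw_poly.
  rewrite (_ : ((a + b).+2 - a.+2)%N = b); last by lia.
  rewrite (_ : ((a + b).+2 - a.+1)%N = b.+1); last by lia.
  rewrite (_ : ((a + b).+2 - a)%N = b.+2); last by lia.
  rewrite derivM !deriv_exp /= derivB derivD derivZ derivX -polyC1 derivC.
  rewrite -!mul_polyC !polyC_natr polyC1 !exprS.
  move: ((1 - 'X : {poly F}) ^+ a) ((1 + p%:R * 'X : {poly F}) ^+ b) => x y.
  by rewrite !natrD !natrM; ring.
rewrite coefB coefD !coefZ coef_Xderiv -/(kraw F p _ _ _) => E.
by rewrite -natrM E natrD natrM /kraw; ring.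
Qed.

(** The recurrence at i = 0, where the term with i - 1 drops out. *)
Lemma kraw1 n d :
  p%:R * n.+1%:R * K n.+1 1 d = (p%:R * n.+1%:R - p.+1%:R * d%:R) * K n.+1 0 d.
Proof.
have /(congr1 (fun r : {poly F} => r`_d)) :
    (p * n.+1)%:R *: kraw_poly F p n.+1 1 = (p * n.+1)%:R *: kraw_poly F p n.+1 0
      - p.+1%:R *: ('X * (kraw_poly F p n.+1 0)^`()).
  rewrite /kraw_poly subn1 subn0 expr0 !mul1r expr1 /=.
  rewrite deriv_exp /= derivD derivZ derivX -polyC1 derivC.
  rewrite -!mul_polyC !polyC_natr polyC1 !exprS.
  move: ((1 + p%:R * 'X : {poly F}) ^+ n) => y.
  by rewrite !natrM; ring.
rewrite coefB !coefZ coef_Xderiv => E.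
by rewrite -natrM [LHS]E natrM /kraw; ring.
Qed.

End KrawtchoukIdentities.

(** * Binomial estimates and the orthogonality relation *)

(** The ratio of consecutive terms C(n, j) p^j is p (n - j) / (j + 1). The upper hypothesis makes
    the terms rise up to d, the lower one makes them fall afterwards, so each of the n + 1 terms of
    (1 + p)^n is at most the d-th. *)
Lemma binomial_mode p n d : (p * n <= p.+1 * d <= p * n + p)%N ->
  (p.+1 ^ n <= n.+1 * ('C(n, d) * p ^ d))%N.
Proof.
move=> /andP[lo hi]; pose c j := ('C(n, j) * p ^ j)%N.
have step j : (j.+1 * c j.+1 = p * (n - j) * c j)%N.
  by rewrite /c expnS mulnA mul_bin_left; nia.
have up k : (k <= d -> c (d - k) <= c d)%N.
  elim: k => [|k IH] kd; first by rewrite subn0.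
  apply: leq_trans (IH (ltnW kd)); rewrite -(subnSK kd).
  have := step (d - k.+1)%N; set j := (d - k.+1)%N => Ej.
  rewrite -(leq_pmul2l (ltn0Sn j)) Ej leq_mul2r; apply/orP; right; nia.
have down k : (c (d + k) <= c d)%N.
  elim: k => [|k IH]; first by rewrite addn0.
  apply: leq_trans IH; rewrite addnS.
  by rewrite -(leq_pmul2l (ltn0Sn (d + k))) step leq_mul2r; apply/orP; right; nia.
have max j : (c j <= c d)%N.
  case: (leqP j d) => [jd | /ltnW dj].
    by rewrite -(subKn jd) up // leq_subr.
  by rewrite -(subnKC dj) down.
rewrite -[p.+1]addn1 addnC expnDn -[n.+1 in leqRHS]card_ord -sum_nat_const.
by apply: leq_sum => j _; rewrite exp1n mul1n; apply: max.
Qed.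

Lemma expn2_bin j n : (j.*2 <= n -> 2 ^ j <= 'C(n, j))%N.
Proof.
elim: j n => [|j IH] [|n] jn //.
rewrite -(leq_pmul2l (ltn0Sn j)) -mul_bin_diag.
apply: (leq_trans (n := (n.+1 * 2 ^ j)%N)); first by rewrite expnS; nia.
by rewrite leq_mul2l IH //; lia.
Qed.

(** Source of the threshold 14: at n = 13 the two sides are 2366 and 2048. *)
Lemma cubic_expn2 n : (14 <= n -> n.+1 * n ^ 2 <= 2 ^ (n - 2))%N.
Proof.
elim: n => // n IH; rewrite ltnS leq_eqVlt => /predU1P[<- // | n14].
have {}IH := IH n14; rewrite subSn ?expnS; [|lia].
apply: leq_trans (leq_mul (leqnn 2) IH); nia.
Qed.

(** Parseval for one row of the adjacency matrix, expanded in the idempotents, gives sum_T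
    K_d(|T|)^2 p^|T| = q^n K_d(0). Only the C(n, i) equal terms with |T| = i are kept. *)
Lemma kraw_l2 (S : finType) n i d : (0 < #|S|)%N -> (i <= n)%N ->
  ('C(n, i) * #|S|.-1 ^ i)%:R * kraw int #|S|.-1 n i d ^+ 2
    <= #|S|%:R ^+ n * kraw int #|S|.-1 n 0 d.
Proof.
move=> S_gt0 le_in; set p := #|S|.-1; set K := kraw int p n.
have /card_gt0P[s _] := S_gt0.
pose u : {ffun 'I_n -> S} := [ffun=> s].
set N : int := #|S|%:R ^+ n.
have N_gt0 : 0 < N by rewrite exprn_gt0 // ltr0n.
pose w (T : {set 'I_n}) v := K #|T| d * scheme_ker int T u v.
have adjE v : N *+ hamming_rel d u v = \sum_(T : {set 'I_n}) w T v by exact: hamming_relE.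
have corr (T U : {set 'I_n}) : \sum_v w T v * w U v =
    if T == U then N * K #|T| d ^+ 2 * p%:R ^+ #|T| else 0.
  transitivity (K #|T| d * K #|U| d * \sum_v scheme_ker int T u v * scheme_ker int U v u).
    rewrite mulr_sumr; apply: eq_bigr => v _.
    by rewrite /w (scheme_ker_sym int U v u); ring.
  rewrite scheme_ker_mul; case: eqP => [<-|_]; last by rewrite mulr0.
  by rewrite scheme_ker_diag // -/p; ring.
have sumsq : \sum_v (N *+ hamming_rel d u v) ^+ 2 =
    N * \sum_(T : {set 'I_n}) K #|T| d ^+ 2 * p%:R ^+ #|T|.
  transitivity (\sum_v \sum_T \sum_U w T v * w U v).
    apply: eq_bigr => v _; rewrite adjE expr2 mulr_suml.
    by apply: eq_bigr => T _; rewrite mulr_sumr.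
  rewrite exchange_big mulr_sumr; apply: eq_bigr => T _ /=.
  rewrite exchange_big (bigD1 T) //= corr eqxx big1 ?addr0 ?mulrA // => U.
  by rewrite eq_sym corr => /negPf ->.
(* Pairing the row with the constant function, the kernel of the empty set, kills every other T; so
   the degree is K_d(0). *)
have sum1 : \sum_v N *+ hamming_rel d u v = N * K 0 d.
  transitivity (\sum_v \sum_T scheme_ker int set0 u v * w T v).
    by apply: eq_bigr => v _; rewrite adjE; apply: eq_bigr => T _; rewrite scheme_ker0 mul1r.
  rewrite exchange_big /= (bigD1 set0) //=.
  transitivity (K 0 d * (N * 1) + 0); last by ring.
  congr (_ + _).
    rewrite -[X in _ * (_ * X)](scheme_ker0 int u u).
    have := scheme_ker_mul int set0 set0 u u; rewrite eqxx -/N => <-.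
    rewrite mulr_sumr; apply: eq_bigr => v _.
    by rewrite /w cards0 (scheme_ker_sym int _ v u); ring.
  apply: big1 => T T0.
  transitivity (K #|T| d * \sum_v scheme_ker int set0 u v * scheme_ker int T v u).
    rewrite mulr_sumr; apply: eq_bigr => v _.
    by rewrite /w (scheme_ker_sym int _ v u); ring.
  by rewrite scheme_ker_mul eq_sym (negPf T0) mulr0.
have sq1 : \sum_v (N *+ hamming_rel d u v) ^+ 2 = N * (N * K 0 d).
  rewrite -sum1 mulr_sumr; apply: eq_bigr => v _.
  by case: (hamming_rel d u v); rewrite ?mulr1n ?mulr0n ?expr2 ?mulr0.
rewrite -(ler_pM2l N_gt0) -sq1 sumsq ler_pM2l //.
rewrite (bigID (fun T : {set 'I_n} => #|T| == i)) /=.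
rewrite -[leLHS]addr0 lerD //; last first.
  by apply: sumr_ge0 => T _; rewrite mulr_ge0 ?sqr_ge0 ?exprn_ge0.
rewrite (eq_bigr (fun=> K i d ^+ 2 * p%:R ^+ i)) => [|T /eqP -> //].
have := card_draws 'I_n i; rewrite card_ord cardsE => draws.
by rewrite sumr_const draws -mulr_natl natrM natrX; lia.
Qed.

(** * The smallest Krawtchouk value *)

(** Multiplies a coefficient list by 1 + c X, with [x] the coefficient carried over from the
    previous position. Binary integers keep the evaluation by [vm_compute] feasible. *)
Fixpoint mul_lin (c x : Z) (s : seq Z) : seq Z :=
  if s is y :: s' then (y + c * x) :: mul_lin c y s' else [:: c * x].

Definition kraw_seq (p n i : nat) : seq Z :=
  iter i (mul_lin (-1) 0) (iter (n - i) (mul_lin p%:R 0) [:: 1]).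

Lemma nth_mul_lin c x s j : (mul_lin c x s)`_j = s`_j + c * (x :: s)`_j.
Proof.
elim: s x j => [|y s IH] x [|j] //=.
  by rewrite add0r; case: j => [|j]; rewrite nth_nil mulr0.
Qed.

Lemma nth_mul_lin_poly c s (f : {poly Z}) : (forall j, s`_j = f`_j) ->
  forall j, (mul_lin c 0 s)`_j = (f * (1 + c *: 'X))`_j.
Proof.
move=> sf j; rewrite nth_mul_lin mulrDr mulr1 -scalerAr coefD coefZ coefMX sf.
by case: j => [|j] //=; rewrite sf.
Qed.

Lemma nth_kraw_seq p n i j : (kraw_seq p n i)`_j = kraw Z p n i j.
Proof.
rewrite /kraw /kraw_poly mulrC.
have base k : forall j, (iter k (mul_lin p%:R 0) [:: 1])`_j =
    ((1 + p%:R *: 'X : {poly Z}) ^+ k)`_j.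
  elim: k => [|k IH] l.
    by rewrite expr0 coef1; case: l => [|[|l]].
  by rewrite iterS exprSr (nth_mul_lin_poly _ IH).
rewrite /kraw_seq; elim: i (n - i)%N j => [|i IH] k l.
  by rewrite expr0 mulr1; apply: base.
rewrite iterS exprSr mulrA; have := nth_mul_lin_poly (-1) (IH k) l.
by rewrite scaleN1r.
Qed.

(* Only the lower bound is tested: for n = 4, p = 2, d = 3, i = 3 the absolute
   value exceeds it (5 > 32 / 8). *)
Definition kraw_small_check : bool :=
  all (fun n => all (fun p => all (fun d => all (fun m =>
    (p.+1 * d == p * n + m)%N ==>
    all (fun i =>
      0 <= (p * (n.-1 + m))%:R * (kraw_seq p n i)`_d + (kraw_seq p n 0)`_d) (iota 1 n))
    (iota 0 2)) (iota 0 n.+1)) (iota 2 11)) (iota 0 14).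

Lemma kraw_small_checkE : kraw_small_check.
Proof. by vm_compute. Qed.

Lemma kraw_bound_small p n d m i :
  (1 < p)%N -> (n < 14)%N -> (d <= n)%N -> (m <= 1)%N ->
  (p.+1 * d = p * n + m)%N -> (0 < i <= n)%N ->
  0 <= (p * (n.-1 + m))%:R * kraw int p n i d + kraw int p n 0 d.
Proof.
move=> p1 n14 dn m1 dE /andP[i0 i_n].
(* Since (p + 1)(n - d) = n - m, the case p >= 13 >= n forces d = n = m = 1; smaller p lie in the
   range of the check. *)
have [p12|p12] := ltnP 12 p.
  have dn' : d = n by nia.
  have [n1 m1'] : n = 1%N /\ m = 1%N by nia.
  have i1 : i = 1%N by lia.
  subst; rewrite kraw_diag kraw0 !binn; lia.
have n_in : n \in iota 0 14 by rewrite mem_iota; lia.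
have p_in : p \in iota 2 11 by rewrite mem_iota; lia.
have d_in : d \in iota 0 n.+1 by rewrite mem_iota; lia.
have m_in : m \in iota 0 2 by rewrite mem_iota; lia.
have i_in : i \in iota 1 n by rewrite mem_iota; lia.
have /allP/(_ n n_in)/allP/(_ p p_in)/allP/(_ d d_in)/allP/(_ m m_in) := kraw_small_checkE.
rewrite dE eqxx implyTb => /allP/(_ i i_in).
rewrite !nth_kraw_seq -!(rmorph_kraw (int_of_Z : {rmorphism Z -> int})).
by rewrite -(rmorph_nat int_of_Z) -rmorphM -rmorphD; case: (_ + _).
Qed.

(** The recurrence gives p (n - i) K(i + 1) = - (m + (p - 1) i) K(i) - i K(i - 1). While 2 (i + 1)
    <= n + 1, the coefficients on the right have absolute sum m + p i <= p (i + 1) <= p (n - i), so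
    a bound on two consecutive values passes to the next. *)
Lemma kraw_bound_rec p n d m i :
  (1 < p)%N -> (1 < n)%N -> (m <= 1)%N -> (p.+1 * d = p * n + m)%N ->
  (0 < i)%N -> (i.*2 <= n.+1)%N ->
  `|(p * (n.-1 + m))%:R * kraw int p n i d| <= kraw int p n 0 d.
Proof.
move=> p1 n1 m1 dE i0 i_n.
set x : int := (p * (n.-1 + m))%:R; set K := fun i => kraw int p n i d.
have D_ge0 : 0 <= K 0%N by rewrite /K kraw0 ler0n.
have qdE : p.+1%:R * d%:R = p%:R * n%:R + m%:R :> int by rewrite -!natrM dE natrD natrM.
have K1E : p%:R * n%:R * K 1%N = - m%:R * K 0%N.
  rewrite /K; case: n n1 qdE {x i_n dE K D_ge0} => // n' _ qdE.
  by rewrite kraw1 qdE; ring.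
have rec a b : n = (a + b).+2 -> p%:R * b.+1%:R * K a.+2 =
    - (m%:R + (p%:R - 1) * a.+1%:R) * K a.+1 - a.+1%:R * K a.
  move=> nE; have := kraw_rec int p a b d; rewrite -nE -!/(K _) qdE nE.
  move=> /eqP; rewrite -subr_eq0 => /eqP E.
  by apply/eqP; rewrite -subr_eq0 -E; apply/eqP; ring.
have p_neq0 : p%:R != 0 :> int by lia.
have n_neq0 : n%:R != 0 :> int by lia.
have n1_neq0 : n%:R - 1 != 0 :> int by lia.
(* Starting values. The bound is attained at i = 2, which explains the constant p (n - 1 + m). *)
have [K1n K2n] : [/\ x * K 1%N = - m%:R * K 0%N & x * K 2%N = - K 0%N].
  have := rec 0%N (n - 2)%N ltac:(lia).
  rewrite (_ : (n - 2).+1%:R = n%:R - 1); last by lia.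
  rewrite mul1r => K2E.
  have : m = 0%N \/ m = 1%N by lia.
  case=> m01; move: K1E K2E; rewrite /x m01 ?addn0 ?addn1 ?prednK; try lia.
    rewrite oppr0 mul0r => /eqP; rewrite !mulf_eq0 (negPf p_neq0) (negPf n_neq0) /=.
    move=> /eqP ->; rewrite mulr0 => E; split; first by rewrite mulr0.
    rewrite natrM (_ : n.-1%:R = n%:R - 1); last lia.
    by rewrite E; ring.
  rewrite natrM => E1 E2; split=> //.
  apply: (mulfI (mulf_neq0 n1_neq0 p_neq0)).
  have : n%:R * (p%:R * (n%:R - 1) * K 2%N) = n%:R * (- (1 + (p%:R - 1) * 1) * K 1%N - K 0%N).
    by rewrite E2.
  have : p%:R * (p%:R * n%:R * K 1%N) = p%:R * (- 1 * K 0%N) by rewrite E1.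
  nia.
have step a : (a.+2.*2 <= n.+1)%N -> `|x * K a| <= K 0%N -> `|x * K a.+1| <= K 0%N ->
    `|x * K a.+2| <= K 0%N.
  move=> an Ka Ka1; have nE : n = (a + (n - a - 2)).+2 by lia.
  have := rec _ _ nE; set b := (n - a - 2)%N => E.
  have pb_gt0 : 0 < p%:R * b.+1%:R :> int by rewrite mulr_gt0 ?ltr0n //; lia.
  rewrite -(ler_pM2l pb_gt0) -{1}(gtr0_norm pb_gt0) -normrM mulrCA E.
  set c : int := m%:R + (p%:R - 1) * a.+1%:R.
  have c_ge0 : 0 <= c by rewrite addr_ge0 ?mulr_ge0 //; lia.
  have cb : c + a.+1%:R <= p%:R * b.+1%:R.
    have ab : (a.+2 <= b.+1)%N by lia.
    apply: (le_trans (y := p%:R * a.+2%:R)); first by rewrite /c; lia.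
    by rewrite ler_wpM2l // ler_nat.
  have -> : x * (- c * K a.+1 - a.+1%:R * K a) =
      - (c * (x * K a.+1) + a.+1%:R * (x * K a)) by ring.
  rewrite normrN; apply: le_trans (ler_normD _ _) _.
  rewrite [`|c * _|]normrM [`|a.+1%:R * _|]normrM (ger0_norm c_ge0) normr_nat.
  apply: le_trans (ler_wpM2r D_ge0 cb); rewrite [leRHS]mulrDl.
  by apply: lerD; apply: ler_wpM2l.
have [j iE] : exists j, i = j.+1 by exists i.-1; lia.
suff H l : (l.+1.*2 <= n.+1)%N -> `|x * K l.+1| <= K 0%N /\
   ((l.+2.*2 <= n.+1)%N -> `|x * K l.+2| <= K 0%N) by rewrite iE in i_n *; case: (H j i_n).
elim: l => [|l IH] ln.
  rewrite K1n K2n normrN (ger0_norm D_ge0); split=> //.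

  case: (m) m1 => [|[|//]] _; first by rewrite oppr0 mul0r normr0.
  by rewrite mulN1r normrN (ger0_norm D_ge0).
have [h1 h2] := IH ltac:(lia).
by split=> [|ln']; [exact: h2 | apply: step ln' h1 (h2 ln)].
Qed.

(** With x = p (n - 1 + m), the chain is (n + 1) x^2 K(i)^2 <= C(n, i) p^i K(i)^2 <= q^n K(0) <= (n
    + 1) K(0)^2. *)
Lemma kraw_bound_l2 p n d m i :
  (1 < p)%N -> (14 <= n)%N -> (m <= 1)%N -> (p.+1 * d = p * n + m)%N ->
  (n.+2 <= i.*2)%N -> (i <= n)%N ->
  `|(p * (n.-1 + m))%:R * kraw int p n i d| <= kraw int p n 0 d.
Proof.
move=> p1 n14 m1 dE ni i_n.
set x : nat := (p * (n.-1 + m))%N; set D := kraw int p n 0 d; set k := kraw int p n i d.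
have D_ge0 : 0 <= D by rewrite /D kraw0 ler0n.
have xC : (x ^ 2 * n.+1 <= 'C(n, i) * p ^ i)%N.
  have xp : (x <= p * n)%N by rewrite leq_mul2l; apply/orP; right; lia.
  apply: (leq_trans (n := (p ^ 2 * (n.+1 * n ^ 2))%N)).
    rewrite [(_.+1 * _)%N]mulnC mulnA -expnMn leq_mul2r; apply/orP; right.
    by rewrite leq_exp2r.
  apply: (leq_trans (n := (p ^ 2 * 2 ^ (n - 2))%N)); first by rewrite leq_mul2l cubic_expn2 ?orbT.
  (* Here 2^(n - i) <= C(n, n - i) because 2 (n - i) <= n, and 2^(i - 2) <= p^(i - 2). *)
  rewrite (_ : (n - 2)%N = ((n - i) + (i - 2))%N); last by lia.
  rewrite -(bin_sub i_n) expnD mulnCA leq_mul ?expn2_bin //; first by lia.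
  rewrite -{2}(_ : (2 + (i - 2))%N = i); last by lia.
  by rewrite expnD leq_mul2l; apply/orP; right; rewrite leq_exp2r //; lia.
have qD : p.+1%:R ^+ n <= n.+1%:R * D.
  rewrite /D kraw0 -natrX -natrM ler_nat; apply: binomial_mode; lia.
have := @kraw_l2 'I_p.+1 n i d; rewrite card_ord => /(_ isT i_n) /=; rewrite -/D -/k => l2.
rewrite -(@ler_pXn2r _ 2) ?nnegrE // real_normK ?num_real // exprMn.
rewrite -(ler_pM2l (x := n.+1%:R)) ?ltr0n //.
apply: le_trans (_ : ('C(n, i) * p ^ i)%:R * k ^+ 2 <= _).
  by rewrite mulrA -natrX -natrM mulnC ler_wpM2r ?sqr_ge0 // ler_nat.
by apply: le_trans l2 _; rewrite expr2 mulrA ler_wpM2r.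
Qed.

Lemma kraw_bound p n d m i :
  (1 < p)%N -> (d <= n)%N -> (m <= 1)%N -> (p.+1 * d = p * n + m)%N ->
  (0 < i <= n)%N ->
  0 <= (p * (n.-1 + m))%:R * kraw int p n i d + kraw int p n 0 d.
Proof.
move=> p1 dn m1 dE i0n; have [n14|n14] := ltnP n 14; first exact: kraw_bound_small.
have /andP[i0 i_n] := i0n.
suff : `|(p * (n.-1 + m))%:R * kraw int p n i d| <= kraw int p n 0 d.
  by rewrite ler_norml => /andP[+ _]; rewrite -subr_ge0 opprK.
have [i2|i2] := leqP i.*2 n.+1; first by apply: kraw_bound_rec => //; lia.
exact: kraw_bound_l2.
Qed.

(** * The lower bound for all positive m *)

(** The generating polynomial has degree at most n. This covers the Pascal step in which d + 1
    exceeds the smaller length. *)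
Lemma kraw_out (F : comNzRingType) p n i d : (i <= n)%N -> (n < d)%N -> kraw F p n i d = 0.
Proof.
move=> le_in nd; apply: nth_default; apply: leq_trans nd.
have lin (a b : F) k : (size ((a%:P + b *: 'X) ^+ k) <= k.+1)%N.
  apply: leq_trans (size_poly_exp_leq _ _) _; rewrite ltnS.
  apply: leq_trans (_ : 1 * k <= k)%N; last by rewrite mul1n.
  rewrite leq_mul2r; apply/orP; right; rewrite -ltnS.
  have : (size (a%:P + b *: 'X)%R <= 2)%N.
    apply: leq_trans (size_polyD _ _) _; rewrite geq_max.
    rewrite (leq_trans (size_polyC_leq1 _)) //.
    by rewrite (leq_trans (size_scale_leq _ _)) // size_polyX.
  by case: (size _) => [|[|]].
rewrite /kraw_poly; apply: leq_trans (size_polyMleq _ _) _.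
have h1 := lin 1 (-1) i; have h2 := lin 1 p%:R (n - i)%N.
rewrite polyC1 scaleN1r in h1; rewrite polyC1 in h2.
apply: leq_trans (_ : (i.+1 + (n - i).+1).-1 <= _)%N; last by lia.
by rewrite -!subn1 leq_sub2r // leq_add.
Qed.

Lemma linear_expn p d : (1 < p)%N -> (0 < d)%N -> (p.+1 * d <= 2 * (p ^ d).+1)%N.
Proof.
move=> p1; elim: d => // -[_ _|d IH _]; first by rewrite expn1; lia.
have := IH isT; rewrite [(p ^ d.+2)%N]expnS.
have : (p <= p ^ d.+1)%N by rewrite -{1}[p]expn1 leq_exp2l.
nia.
Qed.

(* Both sides satisfy the Pascal recursion expressing (n + 1, d + 1) through
   (n, d + 1) and (n, d), along which m becomes m + p and m - 1; hence m = 1 is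
   the base case. *)
Lemma kraw_min p n d m i :
  (1 < p)%N -> (d <= n)%N -> (0 < m)%N -> (p.+1 * d = p * n + m)%N ->
  (0 < i <= n)%N ->
  0 <= (p * n)%:R * kraw int p n i d + m%:R * kraw int p n 0 d.
Proof.
move=> p1; elim: n d m => [|n IH] d m dn m0 dE /andP[i0 i_n]; first by lia.
have [m1|m1] := leqP m 1.
  have := kraw_bound p1 dn m1 dE; rewrite (_ : m = 1%N); last by lia.
  by rewrite mul1r addn1; apply; rewrite i0.
(* The Pascal recursion requires i <= n, so i = n + 1 is done directly. The two values are (-1)^d
   C(n + 1, d) and p^d C(n + 1, d), and p (n + 1) = (p + 1) d - m <= 2 p^d + 2 - m <= m p^d because
   m >= 2. *)
move: i_n; rewrite leq_eqVlt => /predU1P[-> | i_n].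
  have pd : (p * n.+1 <= m * p ^ d)%N.
    have d_gt0 : (0 < d)%N by lia.
    have := linear_expn p1 d_gt0.
    have : (2 * p ^ d + m <= m * p ^ d + 2 * m)%N by nia.
    nia.
  have {}pd : (p * n.+1)%:R <= m%:R * (p ^ d)%:R :> int by rewrite -natrM ler_nat.
  have mpd_ge0 : 0 <= (p * n.+1)%:R :> int by [].
  rewrite kraw_diag kraw0 natrM -signr_odd.
  rewrite (_ : _ + _ = 'C(n.+1, d)%:R *
    ((p * n.+1)%:R * (-1) ^+ odd d + m%:R * (p ^ d)%:R)); last by ring.
  by rewrite mulr_ge0 //; case: (odd d); rewrite ?expr1 ?expr0; lra.
case: d => [|d] in dn dE *; first by lia.
rewrite !krawS //.
have n0 : (0 < n)%N by lia.
set x := kraw int p n i d.+1; set y := kraw int p n i d.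
set X := kraw int p n 0 d.+1; set Y := kraw int p n 0 d.
have hy : 0 <= (p * n)%:R * y + (m.-1)%:R * Y.
  by apply: IH; rewrite ?i0 //; lia.
have hx : 0 <= (p * n)%:R * x + (m + p)%:R * X.
  have [dn'|dn'] := ltnP d n; first by apply: IH; rewrite ?i0 //; lia.
  by rewrite /x /X !kraw_out ?mulr0 //; lia.
have XY : d.+1%:R * X = (n - d)%:R * (p%:R * Y).
  rewrite /X /Y !kraw0 -!natrM mulnA mul_bin_left expnS; congr (_%:R); nia.
have n_gt0 : 0 < n%:R :> int by rewrite ltr0n.
rewrite -(pmulr_rge0 _ n_gt0).
suff -> : n%:R * ((p * n.+1)%:R * (x + p%:R * y) + m%:R * (X + p%:R * Y)) =
    n.+1%:R * (((p * n)%:R * x + (m + p)%:R * X) + p%:R * ((p * n)%:R * y + m.-1%:R * Y)).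
  by rewrite mulr_ge0 // addr_ge0 // mulr_ge0.
have m'E : m.-1%:R = m%:R - 1 :> int by lia.
have mE : m%:R = p.+1%:R * d.+1%:R - p%:R * n.+1%:R :> int.
  by rewrite -!natrM dE natrD; ring.
have XYz : (d%:R + 1) * X = (n%:R - d%:R) * (p%:R * Y).
  by rewrite natr1 XY natrB //; lia.
apply/eqP; rewrite -subr_eq0 !natrM !natrD m'E mE -!natr1; apply/eqP.
(* After substituting m, the two sides differ by this multiple of the relation between K_d(0) and
   K_(d+1)(0) at length n. *)
transitivity ((p%:R + 1) * ((n%:R - d%:R) * (p%:R * Y) - (d%:R + 1) * X)); first by ring.
by rewrite XYz subrr mulr0.
Qed.

(** * From eigenvalue bounds to the quantum chromatic number *)

Lemma chromatic_hoffman (R : realType) (S : finType) n d (d_gt0 : (0 < d)%N)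
    (c e : int) :
  (1 < #|S|)%N -> (d <= n)%N -> 0 <= c -> 0 <= e ->
  (forall i, (0 < i <= n)%N ->
    0 <= c * kraw int #|S|.-1 n i d + e * kraw int #|S|.-1 n 0 d) ->
  c + e <= e * (quantum_chromatic_number R (hamming_graph n S d_gt0))%:Z.
Proof.
move=> S1 dn c_ge0 e_ge0 eig; rewrite /quantum_chromatic_number.
case: ex_minnP => r /asboolP[k [k_gt0 [P [Pherm Psum Porth Padj]]]] _.
apply: (@quantum_hoffman R[i] S n d r k _ k_gt0 P) => //.
- exact: ltnW.
- move=> v a x y; have /is_hermitianmxP/matrixP/(_ x y) := Pherm v a.
  by rewrite expr0 scale1r !mxE.
- by move=> v a; rewrite Porth eqxx.
(* Non-adjacent colours in a complete graph are equal colours. *)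
- by move=> u v a uv; apply: Padj => //; rewrite /= /complete_rel eqxx.
- rewrite kraw0 ltr0n muln_gt0 bin_gt0 dn expn_gt0; apply/orP; left; lia.
Qed.

Unset Implicit Arguments.

Theorem theorem1p2 (R : realType) (S : finType) (n q d : nat)
    (hn : (0 < n)%N) (hS : #|S| = q) (hq : (3 <= q)%N)
    (hd : (0 < d)%N) (hdn : (d <= n)%N) :
  (d%:R = (q%:R - 1) * n%:R / q%:R :> R ->
     (q%:R - 1) * (n%:R - 1) + 1
       <= (quantum_chromatic_number R (hamming_graph n S hd))%:R :> R) /\
  (((q%:R - 1) * n%:R + 1) / q%:R <= d%:R :> R ->
     (q%:R * d%:R) / (q%:R * d%:R - (q%:R - 1) * n%:R)
       <= (quantum_chromatic_number R (hamming_graph n S hd))%:R :> R).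
Proof.
have [p qE] : exists p, q = p.+1 by exists q.-1; lia.
have p1 : (1 < p)%N by lia.
have SE : #|S|.-1 = p by rewrite hS qE.
have S1 : (1 < #|S|)%N by lia.
have qR : q%:R - 1 = p%:R :> R by rewrite qE -natr1 addrK.
have qR_gt0 : 0 < q%:R :> R by rewrite ltr0n; lia.
split=> [dE | dge].
  have dN : (p.+1 * d = p * n + 0)%N.
    apply/eqP; rewrite -(eqr_nat R) addn0 !natrM -qE dE qR; apply/eqP.
    by field; rewrite gt_eqF.
  (* The case m = 0 with c = p (n - 1) and e = 1. *)
  have : (p * n.-1)%:R + 1 <= 1 * (quantum_chromatic_number R (hamming_graph n S hd))%:Z.
    apply: chromatic_hoffman => // i i_n.
    rewrite SE mul1r; have := kraw_bound p1 hdn (leq0n 1) dN i_n.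
    by rewrite addn0.
  rewrite mul1r -(ler_int R) rmorphD /= => le; rewrite qR.
  apply: le_trans le.
  by rewrite mulr1z rmorph_nat natrM -subn1 natrB.
pose m := (p.+1 * d - p * n)%N.
have pd_gt : (p * n + 1 <= p.+1 * d)%N.
  move: dge; rewrite ler_pdivrMr // qR => dge.
  by rewrite -(ler_nat R) natrD !natrM -qE [leRHS]mulrC.
have dN : (p.+1 * d = p * n + m)%N by lia.
have m0 : (0 < m)%N by lia.
have mE : q%:R * d%:R - (q%:R - 1) * n%:R = m%:R :> R.
  by rewrite qR -!natrM qE dN natrD addrAC subrr add0r.
rewrite mE ler_pdivrMr ?ltr0n // -!natrM ler_nat.
(* Taking c = p n and e = m gives (c + e) / e = q d / m. *)
have : (p * n)%:R + m%:R <= m%:R * (quantum_chromatic_number R (hamming_graph n S hd))%:Z.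
  apply: chromatic_hoffman => // i i_n.
  by rewrite SE; apply: kraw_min.
by rewrite qE dN; lia.
Qed.
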